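(* Let $n\ge 2$, let $M:=\mathbf{P}(n,\mathbb{N})\cong\mathbb{N}^{n-1}$, and let $S$ be a unipotent numerical monoid in $M$ whose generating number $k:=\mathtt{r}_M(S)$ is at least $2$. Let $\mathtt{g}_1,\dots,\mathtt{g}_{n-1}$ denote the genera of the coordinate submonoids $S_1,\dots,S_{n-1}$ of $S$, respectively. Then $$\mathfrak{e}_1(\mathtt{g}_1,\dots,\mathtt{g}_{n-1})\ \le\ \mathtt{g}_M(S)\ \le\ \sum_{j=1}^{n-1}(-1)^{j-1}k^{n-1-j}\,\mathfrak{e}_j(\mathtt{g}_1,\dots,\mathtt{g}_{n-1}).$$
   Context: $\mathbb{N}=\{0,1,2,\dots\}$. $\mathbf{P}(n,\mathbb{N})$ is the monoid of $n\times n$ matrices with entries in $\mathbb{N}$, all diagonal entries $1$, and whose only possibly nonzero off-diagonal entries lie in the first row; reading off the entries in positions $(1,2),\dots,(1,n)$ identifies it with the additive monoid $\mathbb{N}^{n-1}$, and we work in $M=\mathbb{N}^{n-1}$. A unipotent numerical monoid in $M$ is a submonoid $S$ of $M$ with $M\setminus S$ finite. For a positive integer $k$ let $P(k):=\{0\}\cup\{(x_1,\dots,x_{n-1})\in\mathbb{N}^{n-1}:\max_i x_i\ge k\}$. The generating number $\mathtt{r}_M(S)$ is the smallest positive integer $k$ with $P(k)\subseteq S$. The genus is $\mathtt{g}_M(S):=|M\setminus S|$. For $1\le j\le n-1$, the coordinate submonoid $S_j$ is the set of elements of $S$ whose coordinates other than the $j$-th are all $0$, viewed as a submonoid of $\mathbb{N}$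 (it has finite complement), and its genus is $|\mathbb{N}\setminus S_j|$. $\mathfrak{e}_j(x_1,\dots,x_{n-1})=\sum_{1\le i_1<\cdots<i_j\le n-1}x_{i_1}\cdots x_{i_j}$ is the $j$-th elementary symmetric polynomial. *)

(* Defs.v *)
From mathcomp Require Import all_boot all_order all_algebra.
From mathcomp Require Import finmap boolp classical_sets functions cardinality.
From mathcomp Require Import mpoly.

Set Implicit Arguments.
Unset Strict Implicit.
Unset Printing Implicit Defensive.

Import Order.TTheory GRing.Theory Num.Theory.
Local Open Scope classical_set_scope.
Local Open Scope ring_scope.

(* [unipotent d] is N^d; the monoid P(n, N) is identified with
   [unipotent n.-1] through the entries (1,2), ..., (1,n) of its matrices,
   which turns matrix multiplication into addition of row vectors. *)
Notation unipotent d := 'rV[nat]_d.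

Definition unipotent_numerical_monoid d (S : set (unipotent d)) : Prop :=
  GRing.nmod_closed (mem S) /\ finite_set (~` S).

(* P(k) *)
Definition fundamental_monoid d (k : nat) : set (unipotent d) :=
  [set x : unipotent d | x = 0 \/ (k <= \max_(i < d) x ord0 i)%N].
Arguments fundamental_monoid : clear implicits.

Definition generates d (S : set (unipotent d)) : set nat :=
  [set k | (0 < k)%N /\ fundamental_monoid d k `<=` S].

(* r_M(S): the least element of [generates S] (0 if there is none, which
   does not happen when S has finite complement). *)
Definition generating_number d (S : set (unipotent d)) : nat :=
  xget 0%N (generates S `&` lbound (generates S)).

(* The number of elements of the complement of S, provided it is finite;
   used for subsets of N^d and for subsets of N. *)
Definition genus (T : choiceType) (S : set T) : nat := #|` fset_set (~` S)|%fset.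

Definition coordinate_submonoid d (S : set (unipotent d)) (j : 'I_d) : set nat :=
  [set x ord0 j | x in S `&` [set x : unipotent d | forall i, i != j -> x ord0 i = 0]].

(* Value at g of the j-th elementary symmetric polynomial in d variables. *)
Definition elementary d (j : nat) (g : 'I_d -> nat) : int :=
  (mesym d int j).@[fun i => (g i)%:Z].

Lemma generating_numberP d (S : set (unipotent d)) :
    unipotent_numerical_monoid S ->
  generates S (generating_number S) /\ lbound (generates S) (generating_number S).
Proof.
move=> [[S0 _] Sfin].
pose m (x : unipotent d) := (\max_(i < d) x ord0 i)%N.
have exk : exists k, `[< generates S k >].
  exists (\sum_(x <- fset_set (~` S)) m x)%N.+1; apply/asboolP; split=> // x.
  case=> [->|]; first by rewrite inE in S0; exact: S0.
  move=> xm; apply: contrapT => Sx; move: xm; apply/negP.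
  rewrite -leqNgt -[X in (X <= _)%N]/(m x).
  have xS : x \in fset_set (~` S) by rewrite in_fset_set // inE.
  by rewrite (big_rem x) //= leq_addr.
case: (ex_minnP exk) => k /asboolP Gk kmin.
have := @xgetPex _ 0%N (generates S `&` lbound (generates S)).
by apply; exists k; split=> // l Gl; apply: kmin; apply/asboolP.
Qed.

(* Main.v *)
(* With k the generating number, every gap of S lies in the box [0, k)^(n-1).
   The gaps of the S_j embed as pairwise disjoint sets of gaps of S on the
   coordinate axes, which gives the lower bound. A point of the box all of whose
   coordinates x_j lie in S_j is a sum of elements of S, so the box contains at
   least prod_j (k - g_j) elements of S; expanding k^(n-1) - prod_j (k - g_j) in
   elementary symmetric polynomials gives the upper bound. *)
Require Import Defs.
From mathcomp Require Import all_boot all_order all_algebra.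
From mathcomp Require Import finmap boolp classical_sets functions cardinality.
From mathcomp Require Import mpoly.
Import Order.TTheory GRing.Theory Num.Theory.

Local Open Scope ring_scope.

Lemma elementaryE d j (g : 'I_d -> nat) :
  elementary j g = \sum_(h : {set 'I_d} | #|h| == j) \prod_(i in h) (g i)%:Z.
Proof.
rewrite /elementary /mesym raddf_sum /=; apply: eq_bigr => h _.
by rewrite rmorph_prod; apply: eq_bigr => i _; rewrite /= mevalXU.
Qed.

Lemma elementary1 d (g : 'I_d -> nat) : elementary 1 g = (\sum_i g i)%N%:Z.
Proof.
rewrite /elementary mesym1E raddf_sum -natz natr_sum /=; apply: eq_bigr => i _.
by rewrite mevalXU natz.
Qed.

(** Expanding the product chooses a set [h] of factors that contribute [- g i], the others
    contributing [k]; grouping the choices by [#|h|] yields the elementary symmetric polynomials. *)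
Lemma prod_subr_elementary d (k : int) (g : 'I_d -> nat) :
  \prod_(i < d) (k - (g i)%:Z) =
  \sum_(0 <= j < d.+1) (-1) ^+ j * k ^+ (d - j) * elementary j g.
Proof.
under eq_bigr do rewrite addrC.
rewrite bigA_distr big_mkord.
have card_h (h : {set 'I_d}) : (#|h| < d.+1)%N.
  by rewrite ltnS -[X in (_ <= X)%N]card_ord max_card.
rewrite (partition_big (fun h : {set 'I_d} => Ordinal (card_h h)) predT) //=.
apply: eq_bigr => j _; rewrite elementaryE big_distrr /=.
apply: eq_big => [h|h /eqP/(congr1 val) /= <-]; first by rewrite -val_eqE.
rewrite (bigID (mem h)) /=.
rewrite (eq_bigr (fun i => - (g i)%:Z)); last by move=> i ->.
rewrite [X in _ * X](eq_bigr (fun=> k)); last by move=> i /negbTE ->.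
rewrite prodrN prodr_const mulrAC.
congr (_ * _ * _); congr (k ^+ _).
by rewrite -[X in (X - _)%N]card_ord -(cardC (mem h)) addKn.
Qed.

Local Open Scope classical_set_scope.

(** Turns a genus into a count over a finite type as soon as [phi] parametrizes a region containing
    all gaps: below, the box for S and ['I_k] for each S_j. *)
Lemma genus_card (T : choiceType) (F : finType) (phi : F -> T) (A : set T) :
  injective phi -> ~` A `<=` range phi ->
  genus A = #|[pred x | `[< ~ A (phi x) >]]|.
Proof.
move=> phi_inj Aphi.
have finA : finite_set (~` A).
  by apply: (sub_finite_set Aphi); apply: finite_image; exact: finite_finset.
rewrite /genus (_ : fset_set _ = [fset phi x | x in [pred x | `[< ~ A (phi x) >]]]%fset).
  by rewrite card_imfset //= cardE.
apply/fsetP => y; rewrite in_fset_set //; apply/idP/imfsetP => /=.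
  by rewrite inE => Ay; have [x _ xy] := Aphi _ Ay; exists x => //; apply/asboolP; rewrite xy.
by move=> [x /asboolP Ax ->]; rewrite inE.
Qed.

Definition axis d (j : 'I_d) (a : nat) : unipotent d :=
  \row_i (if i == j then a else 0%N).

(** Finite functions parametrize the box, so that its subsets can be counted by [card_ffun] and
    [card_family]. *)
Definition box_point d k (f : {ffun 'I_d -> 'I_k}) : unipotent d := \row_i (f i : nat).

Section Box.
Variables (d k : nat) (S : set (unipotent d)).
Hypotheses (hS : GRing.nmod_closed (mem S)) (hk : fundamental_monoid d k `<=` S).

Lemma box_point_inj : injective (box_point d k).
Proof.
move=> f f' /rowP ff'; apply/ffunP => i; apply: val_inj.
by have := ff' i; rewrite !mxE.
Qed.

Lemma gap_lt x i : ~ S x -> (x ord0 i < k)%N.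
Proof.
move=> Sx; rewrite ltnNge; apply/negP => kx; apply: Sx; apply: hk; right.
by apply: leq_trans kx _; exact: (leq_bigmax (F := fun i => x ord0 i)).
Qed.

Lemma coordinate_submonoidE j a : coordinate_submonoid S j a <-> S (axis d j a).
Proof.
split=> [[x [Sx x0] <-]|Sa].
  rewrite (_ : axis d _ _ = x) //; apply/rowP => i; rewrite mxE.
  by case: eqVneq => [->|/x0].
exists (axis d j a); last by rewrite mxE eqxx.
by split=> // i /negbTE ij; rewrite mxE ij.
Qed.

Lemma mem_box_prod (x : unipotent d) :
  (forall i, coordinate_submonoid S i (x ord0 i)) -> S x.
Proof.
move=> xS; have [S0 SD] := hS.
have -> : x = \sum_j axis d j (x ord0 j).
  apply/rowP => i; rewrite summxE (bigD1 i) //= mxE eqxx big1 ?addr0 // => j ji.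
  by rewrite mxE eq_sym (negbTE ji).
suff: \sum_j axis d j (x ord0 j) \in mem S by rewrite inE.
elim/big_ind: _ => // j _.
by rewrite inE; apply/coordinate_submonoidE.
Qed.

Lemma genus_box : genus S = #|[pred f | `[< ~ S (box_point d k f) >]]|.
Proof.
apply: genus_card; first exact: box_point_inj.
move=> x Sx; exists [ffun i => Ordinal (gap_lt x i Sx)] => //.
by apply/rowP => i; rewrite mxE ffunE [i in RHS]/=.
Qed.

Lemma genus_coordinate j : genus (coordinate_submonoid S j) =
  #|[pred a : 'I_k | `[< ~ coordinate_submonoid S j a >]]|.
Proof.
apply: (genus_card _ _ (@nat_of_ord k)); first exact: val_inj.
move=> a /= Sa; suff ak : (a < k)%N by exists (Ordinal ak).
have Sja : ~ S (axis d j a) by move=> /coordinate_submonoidE.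
have := gap_lt _ j Sja.
by rewrite mxE eqxx.
Qed.

Lemma genus_coordinate_le j : (genus (coordinate_submonoid S j) <= k)%N.
Proof. by rewrite genus_coordinate -[X in (_ <= X)%N]card_ord max_card. Qed.

Lemma sum_genus_coordinate_le (k_gt0 : (0 < k)%N) :
  (\sum_j genus (coordinate_submonoid S j) <= genus S)%N.
Proof.
pose G := [pred p : 'I_d * 'I_k | `[< ~ coordinate_submonoid S p.1 p.2 >]].
have -> : (\sum_j genus (coordinate_submonoid S j) = #|G|)%N.
  under eq_bigr do rewrite genus_coordinate -sum1_card.
  by rewrite pair_big_dep -sum1_card; apply: eq_bigl.
rewrite genus_box.
(* The axis point of [p] as a point of the box; [k_gt0] makes 0 an admissible coordinate. *)
pose F (p : 'I_d * 'I_k) : {ffun 'I_d -> 'I_k} :=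
  [ffun i => if i == p.1 then p.2 else Ordinal k_gt0].
have FE p : box_point d k (F p) = axis d p.1 p.2.
  by apply/rowP => i; rewrite !mxE ffunE; case: ifP.
(* The axes meet only at the origin, which is not a gap; this keeps the gaps on different axes
   apart. *)
have G_neq0 p : p \in G -> p.2 != 0%N :> nat.
  case: p => j a /asboolP /= Ga; apply/eqP => a0; apply: Ga.
  apply/coordinate_submonoidE; rewrite a0.
  have [S0 _] := hS; rewrite inE in S0; rewrite (_ : axis d _ _ = 0) //.
  by apply/rowP => i; rewrite !mxE; case: ifP.
rewrite -(card_in_imset (f := F) (D := G)).
  apply/subset_leq_card/fintype.subsetP => _ /imsetP[[j a] /asboolP /= Ga ->].
  by apply/asboolP => /=; rewrite FE => /coordinate_submonoidE.
move=> [j a] [j' a'] Gp Gp' /ffunP FF.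
(* Compare the coordinates at [j]: if [j] differs from [j'], the second point has 0 there, forcing
   [a] to be 0. *)
have := FF j; rewrite !ffunE /= eqxx; case: eqVneq => [-> ->//|_ a0].
by have := G_neq0 _ Gp; rewrite /= a0.
Qed.

Lemma genus_prod_le :
  (genus S + \prod_j (k - genus (coordinate_submonoid S j)) <= k ^ d)%N.
Proof.
pose inS j : pred 'I_k := [pred a | `[< coordinate_submonoid S j (val a) >]].
have cardS j : (k - genus (coordinate_submonoid S j) = #|inS j|)%N.
  rewrite genus_coordinate -[X in (X - _)%N]card_ord -(cardC (inS j)).
  rewrite (@eq_card _ (predC (inS j)) [pred a : 'I_k | `[< ~ coordinate_submonoid S j a >]]).
    by rewrite addnK.
  by move=> a; rewrite !inE asbool_neg.
under eq_bigr do rewrite cardS.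
have -> : (\prod_j #|inS j| = #|family inS|)%N.
  by rewrite card_family foldrE big_map big_enum.
rewrite genus_box -[X in (_ <= X ^ _)%N]card_ord -[X in (_ <= _ ^ X)%N]card_ord -card_ffun.
(* Splitting the box into gaps and elements of S leaves only the inclusion of [family inS] in the
   latter. *)
rewrite -(cardC [pred f | `[< ~ S (box_point d k f) >]]) leq_add2l.
apply/subset_leq_card/fintype.subsetP => f /familyP fS; rewrite !inE asbool_neg negbK.
apply/asboolP/mem_box_prod => i; rewrite mxE; exact/asboolP/fS.
Qed.

End Box.

Theorem proposition5p9 (n : nat) (hn : (2 <= n)%N) (S : set (unipotent n.-1))
    (hS : unipotent_numerical_monoid S) (hk : (2 <= generating_number S)%N) :
  let k := generating_number S in
  let g := fun j : 'I_n.-1 => genus (coordinate_submonoid S j) in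
  elementary 1 g <= (genus S)%:Z /\
  (genus S)%:Z <= \sum_(1 <= j < n)
    (-1) ^+ (j - 1) * k%:Z ^+ (n - 1 - j) * elementary j g.
Proof.
have [[k_gt0 kS] _] := generating_numberP hS.
case: hS => addS _ k g.
split; first by rewrite elementary1 lez_nat; exact: sum_genus_coordinate_le addS kS k_gt0.
case: n hn S {hk} @k @g addS k_gt0 kS => // d _ S k g addS k_gt0 kS.
have -> : \sum_(1 <= j < d.+1)
    (-1) ^+ (j - 1) * k%:Z ^+ (d.+1 - 1 - j) * elementary j g
  = k%:Z ^+ d - \prod_(j < d) (k%:Z - (g j)%:Z).
  (* The term of index 0 is [k ^+ d] and cancels; the remaining terms change sign, which lowers the
     exponent of -1 by one. *)
  rewrite prod_subr_elementary [in RHS]big_ltn // subn0 expr0 mul1r.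
  rewrite {2}/elementary mesym0E meval1 mulr1 opprD addNKr -sumrN.
  apply: eq_big_nat => -[//|j] _.
  by rewrite !subSS !subn0 exprS mulN1r !mulNr opprK.
(* Truncated subtraction is exact here because [g j] is at most [k]. *)
have -> : \prod_(j < d) (k%:Z - (g j)%:Z) = (\prod_(j < d) (k - g j))%N%:Z.
  rewrite -[RHS]natz natr_prod; apply: eq_bigr => j _.
  by rewrite natz subzn //; exact: genus_coordinate_le kS _.
rewrite lerBrDr -PoszD -[k%:Z]natz -natrX natz lez_nat.
exact: genus_prod_le addS kS.
Qed.
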